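(* Let $w_{ij}\ge 0$ for $i\in I$, $j\in J$, with $\sum_{i=1}^m w_{ij}=1$ for every $j\in J$, and let $\lambda\in(0,2)$. Let $T_i:\mathcal{H}\to\mathcal{H}$, $i\in I$, be CW-cutters and CW-WR operators having a common fixed point. Let $T:\mathcal{H}\to\mathcal{H}$ be the operator given by $$(T(x))_j:=x_j+\lambda\sum_{i=1}^m w_{ij}\big((T_i(x))_j-x_j\big),\quad j\in J.$$ Then any sequence generated by the iterative process $$x_j^{k+1}=x_j^k+\lambda\left(\sum_{i=1}^m w_{ij}\big((T_i(x^k))_j-x_j^k\big)\right),\quad j=1,2,\dots,n,\ k\ge 0,$$ where $x^0\in\mathcal{H}$ is arbitrary, converges weakly to some point $x^\ast\in\operatorname{Fix}T=\bigcap_{j\in J}\operatorname{Fix}^{j}T$.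
   Context: Let $n\ge 2$, $J:=\{1,\dots,n\}$, $m\in\mathbb{N}$, $I:=\{1,\dots,m\}$, and let $\mathcal{H}_j$, $j\in J$, be real Hilbert spaces with inner products $\langle\cdot,\cdot\rangle_j$ and induced norms $\|\cdot\|_j$. $\mathcal{H}:=\mathcal{H}_1\times\cdots\times\mathcal{H}_n$ is the product Hilbert space with $\langle x,y\rangle=\sum_{j=1}^n\langle x_j,y_j\rangle_j$ and $\|x\|^2=\sum_j\|x_j\|_j^2$. For $T:\mathcal{H}\to\mathcal{H}$ write $T(x)=((T(x))_1,\dots,(T(x))_n)$ with $(T(x))_j\in\mathcal{H}_j$. $\operatorname{Fix}T=\{z\mid T(z)=z\}$ and $\operatorname{Fix}^{j}T:=\{z\in\mathcal{H}\mid(T(z))_j=z_j\}$. $T$ is a $j$-cutter if $\operatorname{Fix}^{j}T\ne\emptyset$ and $\langle x_j-(T(x))_j,\,z_j-(T(x))_j\rangle_j\le 0$ for all $x\in\mathcal{H}$ and $z\in\operatorname{Fix}^{j}T$; it is a CW-cutter if it is a $j$-cutter for all $j\in J$. $T$ is quasi-nonexpansive (QNE) if $\operatorname{Fix}T\neq\emptyset$ and $\|T(x)-z\|\le\|x-z\|$ for all $x\in\mathcal{H}$, $z\in\operatorname{Fix}T$. (Every CW-cutter is QNE.) A QNE operator $T$ is $j$-weakly regular ($j$-WR) if for any sequence $\{x^k\}_{k=0}^\infty\subseteq\mathcal{H}$ and any $y\in\mathcal{H}$: if $x_j^k\rightharpoonup y_j$ (weak convergence in $\mathcal{H}_j$)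 and $\lim_{k\to\infty}\|(T(x^k))_j-x_j^k\|_j=0$, then $y\in\operatorname{Fix}^{j}T$. $T$ is CW-weakly regular (CW-WR) if it is $j$-WR for all $j\in J$. *)

(* Defs.v *)
From HB Require Import structures.
From mathcomp Require Import all_boot all_order all_algebra.
From mathcomp Require Import all_classical all_reals all_analysis.
From mathcomp Require Import ring lra.

Set Implicit Arguments.
Unset Strict Implicit.
Unset Printing Implicit Defensive.

Import Order.TTheory GRing.Theory Num.Theory.
Import numFieldNormedType.Exports.

Local Open Scope classical_set_scope.
Local Open Scope ring_scope.

HB.mixin Record NormedModule_hasInner (R : realType) V & NormedModule R V := {
  inner : {dot V for idfun} ;
  innerxx : forall x : V, inner x x = `|x| ^+ 2
}.

#[short(type="hilbertType")]
HB.structure Definition Hilbert (R : realType) :=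
  {V of NormedModule_hasInner R V & CompleteNormedModule R V}.

Section dot_norm.
Context {R : realType} {V : lmodType R} (f : {dot V for idfun}).

Lemma dotC x y : f x y = f y x.
Proof. by rewrite hermitian_subproof expr0 mul1r. Qed.

Lemma dotDl x y z : f (x + y) z = f x z + f y z.
Proof. by rewrite dotC linearD /= dotC (dotC z). Qed.

Lemma dotDr x y z : f z (x + y) = f z x + f z y.
Proof. by rewrite linearD. Qed.

Lemma dotZr a x z : f z (a *: x) = a * f z x.
Proof. by rewrite linearZ. Qed.

Lemma dotZl a x z : f (a *: x) z = a * f x z.
Proof. by rewrite dotC dotZr dotC. Qed.

Lemma dot0l z : f 0 z = 0.
Proof. by rewrite -(scale0r 0) dotZl mul0r. Qed.

Lemma dot_gt0 x : x != 0 -> 0 < f x x.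
Proof. exact: neq0_dnorm_gt0. Qed.

Lemma dot_ge0 x : 0 <= f x x.
Proof. by have [->|/dot_gt0/ltW//] := eqVneq x 0; rewrite dot0l. Qed.

Lemma dot_cauchy_schwarz x y : f x y ^+ 2 <= f x x * f y y.
Proof.
have [->|y0] := eqVneq y 0; first by rewrite dotC !dot0l expr0n mulr0.
have yy := dot_gt0 y0.
have := dot_ge0 (f y y *: x + (- f x y) *: y).
rewrite !(dotDl, dotDr, dotZl, dotZr) (dotC y x).
set a := f x x; set b := f x y; set c := f y y in yy *.
have -> : c * (c * a) + c * (- b * b) + (- b * (c * b) + - b * (- b * c)) =
          c * (a * c - b ^+ 2) by ring.
by rewrite pmulr_rge0 // subr_ge0.
Qed.

Definition dot_norm x := Num.sqrt (f x x).

Lemma dot_norm_sq x : dot_norm x ^+ 2 = f x x.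
Proof. by rewrite sqr_sqrtr ?dot_ge0. Qed.

Lemma dot_normD x y : dot_norm (x + y) <= dot_norm x + dot_norm y.
Proof.
have xy0 : 0 <= dot_norm x + dot_norm y by rewrite addr_ge0 ?sqrtr_ge0.
rewrite -(ler_pXn2r (n := 2)) ?nnegrE ?sqrtr_ge0 //.
rewrite sqrrD !dot_norm_sq !(dotDl, dotDr) (dotC y x).
suff : f x y <= dot_norm x * dot_norm y by move=> h; lra.
rewrite (le_trans (ler_norm _)) // -sqrtr_sqr -sqrtrM ?dot_ge0 //.
by rewrite ler_sqrt ?dot_cauchy_schwarz // mulr_ge0 ?dot_ge0.
Qed.

Lemma dot_normZ a x : dot_norm (a *: x) = `|a| * dot_norm x.
Proof.
by rewrite /dot_norm dotZl dotZr mulrA -expr2 sqrtrM ?sqr_ge0 // sqrtr_sqr.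
Qed.

Lemma dot_norm_eq0 x : dot_norm x = 0 -> x = 0.
Proof.
move=> h; apply/eqP/negP => /negP /dot_gt0.
by rewrite -dot_norm_sq h expr0n ltxx.
Qed.

End dot_norm.

(* The Hilbert direct sum; it is an alias of the dependent product so that the
   topology is the one of the Hilbert norm by construction rather than the
   product topology the library puts on [forall j, H j]. *)
Definition hprod (R : realType) (n : nat) (H : 'I_n -> hilbertType R) : Type :=
  forall j, H j.

Section hprod_hilbert.
Context {R : realType} {n : nat} (H : 'I_n -> hilbertType R).
Local Notation P := (hprod H).
Implicit Types x y z : P.

HB.instance Definition _ := gen_eqMixin P.
HB.instance Definition _ := gen_choiceMixin P.

Lemma hprodP x y : (forall j, x j = y j) -> x = y.
Proof. exact: functional_extensionality_dep. Qed.

Definition hprod_zero : P := fun=> 0.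
Definition hprod_add x y : P := fun j => x j + y j.
Definition hprod_opp x : P := fun j => - x j.
Definition hprod_scale (a : R) x : P := fun j => a *: x j.

Let addA : associative hprod_add.
Proof. by move=> x y z; apply: hprodP => j; exact: addrA. Qed.
Let addC : commutative hprod_add.
Proof. by move=> x y; apply: hprodP => j; exact: addrC. Qed.
Let add0 : left_id hprod_zero hprod_add.
Proof. by move=> x; apply: hprodP => j; exact: add0r. Qed.
Let addN : left_inverse hprod_zero hprod_opp hprod_add.
Proof. by move=> x; apply: hprodP => j; exact: addNr. Qed.

HB.instance Definition _ := GRing.isZmodule.Build P addA addC add0 addN.

Let scaleA a b x : hprod_scale a (hprod_scale b x) = hprod_scale (a * b) x.
Proof. by apply: hprodP => j; exact: scalerA. Qed.
Let scale1 : left_id 1 hprod_scale.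
Proof. by move=> x; apply: hprodP => j; exact: scale1r. Qed.
Let scaleDr : right_distributive hprod_scale +%R.
Proof. by move=> a x y; apply: hprodP => j; exact: scalerDr. Qed.
Let scaleDl x : {morph hprod_scale^~ x : a b / a + b}.
Proof. by move=> a b; apply: hprodP => j; exact: scalerDl. Qed.

HB.instance Definition _ :=
  GRing.Zmodule_isLmodule.Build R P scaleA scale1 scaleDr scaleDl.

Lemma hprodD x y j : (x + y) j = x j + y j. Proof. by []. Qed.
Lemma hprodN x j : (- x) j = - x j. Proof. by []. Qed.
Lemma hprodB x y j : (x - y) j = x j - y j. Proof. by []. Qed.
Lemma hprodZ (a : R) x j : (a *: x) j = a *: x j. Proof. by []. Qed.

Definition hprod_inner x y : R := \sum_(j < n) inner (x j) (y j).

Let inner_linear x : linear_for *%R (hprod_inner x).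
Proof.
move=> a y z; rewrite /hprod_inner mulr_sumr -big_split /=.
by apply: eq_bigr => j _; rewrite dotDr dotZr.
Qed.

Let inner_sym x y : hprod_inner x y = (-1) ^+ false * idfun (hprod_inner y x).
Proof.
by rewrite expr0 mul1r; apply: eq_bigr => j _; rewrite dotC.
Qed.

Let inner_linearl y : linear_for *%R (hprod_inner^~ y).
Proof.
move=> a x z /=; rewrite inner_sym expr0 mul1r /= inner_linear.
by congr (_ * _ + _); rewrite inner_sym expr0 mul1r.
Qed.

Let inner_pos x : x != 0 -> 0 < hprod_inner x x.
Proof.
move=> x0; rewrite lt_neqAle sumr_ge0 ?andbT; last by move=> j _; exact: dot_ge0.
apply: contra x0; rewrite eq_sym psumr_eq0 => [/allP h|j _]; last exact: dot_ge0.
apply/eqP/hprodP => j; apply/eqP/negP => /negP /(dot_gt0 inner).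
by rewrite (eqP (h j (mem_index_enum j))) ltxx.
Qed.

HB.instance Definition _ := bilinear_isBilinear.Build R P P R *%R
  (idfun \; *%R) hprod_inner (inner_linearl, inner_linear).
HB.instance Definition _ :=
  isHermitianSesquilinear.Build R P false idfun hprod_inner inner_sym.
HB.instance Definition _ := isDotProduct.Build R P hprod_inner inner_pos.

Definition hprod_dot : {dot P for idfun} := hprod_inner.

HB.instance Definition _ := Lmodule_isNormed.Build R P
  (dot_normD hprod_dot) (dot_normZ hprod_dot) (@dot_norm_eq0 _ _ hprod_dot).

Let inner_norm x : hprod_dot x x = `|x| ^+ 2.
Proof. by rewrite -dot_norm_sq. Qed.

Lemma hprod_norm_sqE x : `|x| ^+ 2 = \sum_(j < n) `|x j| ^+ 2.
Proof.
by rewrite -inner_norm; apply: eq_bigr => j _; rewrite innerxx.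
Qed.

Lemma hprod_le_norm x j : `|x j| <= `|x|.
Proof.
rewrite -(ler_pXn2r (n := 2)) ?nnegrE // hprod_norm_sqE (bigD1 j) //=.
by rewrite lerDl sumr_ge0 // => i _; rewrite sqr_ge0.
Qed.

Lemma hprod_norm_le x : `|x| <= \sum_(j < n) `|x j|.
Proof.
rewrite -(ler_pXn2r (n := 2)) ?nnegrE ?sumr_ge0 // hprod_norm_sqE.
rewrite expr2 mulr_sumr; apply: ler_sum => j _.
by rewrite expr2 ler_wpM2r // (bigD1 j) //= lerDl sumr_ge0.
Qed.

Let hprod_complete (F : set_system P) : ProperFilter F -> cauchy F -> cvg F.
Proof.
move=> FF Fc.
have Fj j : cvg ((fun x => x j) @ F).
  apply: cauchy_cvg; apply: cauchy_exP => e e0.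
  have /cauchyP /(_ e e0) [x Fx] := Fc.
  exists (x j); rewrite nbhs_simpl /=; apply: filterS Fx => y.
  rewrite -!ball_normE /= -hprodB; apply: le_lt_trans; exact: hprod_le_norm.
apply/cvg_ex; exists (fun j => lim ((fun x => x j) @ F)).
apply/cvgrPdist_lt => e e0.
have en0 : 0 < e / n.+1%:R by rewrite divr_gt0.
have H1 : \forall x \near F, forall j : 'I_n,
   `|lim ((fun x => x j) @ F) - x j| < e / n.+1%:R.
  apply: filter_forall => j.
  by have /cvgrPdist_lt /(_ _ en0) := Fj j.
near=> x; apply: le_lt_trans (hprod_norm_le _) _.
apply: (@le_lt_trans _ _ (\sum_(j < n) (e / n.+1%:R))).
  apply: ler_sum => j _; apply: ltW; move: j; near: x; exact: H1.
rewrite sumr_const card_ord -[ltLHS]mulr_natr -mulrA gtr_pMr // mulrC.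
by rewrite ltr_pdivrMr // mul1r ltr_nat.
Unshelve. all: by end_near. Qed.

HB.instance Definition _ := Uniform_isComplete.Build P hprod_complete.
HB.instance Definition _ := NormedModule_hasInner.Build R P inner_norm.

Lemma hprod_innerE x y : inner x y = \sum_(j < n) inner (x j) (y j).
Proof. by []. Qed.

End hprod_hilbert.

(* By Riesz representation, the continuous linear functionals are the [inner _ h]. *)
Definition weakly_cvg (R : realType) (V : hilbertType R)
    (u : nat -> V) (l : V) : Prop :=
  forall h : V, inner (u k) h @[k --> \oo] --> inner l h.

Definition Fix (X : Type) (T : X -> X) : set X := [set z | T z = z].

Section componentwise.
Context {R : realType} {n : nat} {H : 'I_n -> hilbertType R}.
Implicit Types (j : 'I_n) (T : hprod H -> hprod H).

(* A set of points of the whole product, although the condition only bears on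
   the j-th component. *)
Definition Fixc j T : set (hprod H) := [set z | T z j = z j].

Definition cutter_at j T : Prop :=
  Fixc j T !=set0 /\
  forall x z, Fixc j T z -> inner (x j - T x j) (z j - T x j) <= 0.

Definition cw_cutter T : Prop := forall j, cutter_at j T.

Definition quasi_nonexpansive T : Prop :=
  Fix T !=set0 /\ forall x z, Fix T z -> `|T x - z| <= `|x - z|.

Definition weakly_regular_at j T : Prop :=
  quasi_nonexpansive T /\
  forall (x : nat -> hprod H) (y : hprod H),
    weakly_cvg (fun k => x k j) (y j) ->
    `|T (x k) j - x k j| @[k --> \oo] --> (0 : R) ->
    Fixc j T y.

Definition cw_weakly_regular T : Prop := forall j, weakly_regular_at j T.

End componentwise.

(* Main.v *)
(* Each component of the iteration is Fejer monotone: averaging the cutter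
   inequality [|T_i x - x|^2 <= <T_i x - x, z - x>] with the weights, and using
   convexity of the squared norm, decreases [|x_j - z_j|^2] by at least
   [lambda * (2 - lambda)] times the weighted sum of the [|(T_i x)_j - x_j|^2].
   The residuals therefore vanish for every [i] with [w i j != 0], so by weak
   regularity every weak cluster point of [x_j] is the component of a fixed
   point, and Opial's argument makes it unique. Weak sequential compactness of
   bounded sequences is obtained from ultrafilters: along one, a bounded sequence
   has a weak limit by the Riesz representation, and a diagonal choice of indices
   gives an almost orthogonal sequence of differences, hence one that is weakly
   null. *)
Require Import Defs.
From HB Require Import structures.
From mathcomp Require Import all_boot all_order all_algebra.
From mathcomp Require Import all_classical all_reals all_analysis.
From mathcomp Require Import ring lra.

Set Implicit Arguments.
Unset Strict Implicit.
Unset Printing Implicit Defensive.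

Import Order.TTheory GRing.Theory Num.Theory.
Import numFieldNormedType.Exports.

Local Open Scope classical_set_scope.
Local Open Scope ring_scope.

(** * Ultrafilters and convergence *)

Lemma ultra_fmap (X Y : Type) (f : X -> Y) (U : set_system X) :
  UltraFilter U -> UltraFilter (f @ U).
Proof.
move=> UU; split=> [|G GP fUG]; first exact: fmap_proper_filter.
apply/seteqP; split=> // A GA; rewrite /fmap /=.
have [//|UnA] := in_ultra_setVsetC (f @^-1` A) UU.
have GnA : G (~` A) by apply: fUG.
by case: (@filter_not_empty _ G _); rewrite -(setICr A); exact: filterI.
Qed.

(** If the preimage of a neighbourhood were not in [F], then [F] restricted to its complement would
    be proper, and an ultrafilter above that would contradict the hypothesis. *)
Lemma cvg_ultra (X : Type) (Y : topologicalType) (F : set_system X)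
    (f : X -> Y) (l : Y) : ProperFilter F ->
  (forall U, UltraFilter U -> F `<=` U -> f @ U --> l) -> f @ F --> l.
Proof.
move=> FP fUl A lA; apply: contrapT => FA.
have WP : ProperFilter (within (~` (f @^-1` A)) F).
  apply: Build_ProperFilter_ex => B FB.
  apply: contrapT => B0; apply: FA; change (F (f @^-1` A)).
  apply: (@filterS _ F _ _ _ _ FB) => x nAB.
  by apply: contrapT => nA; apply: B0; exists x; exact: nAB.
have [U [UU WU]] := ultraFilterLemma WP.
have FU : F `<=` U by apply: subset_trans WU; exact: cvg_within.
have UA : U (f @^-1` A) by exact: fUl.
have UnA : U (~` (f @^-1` A)) by apply: WU; exact: withinT.
by case: (@filter_not_empty _ U _); rewrite -(setICr (f @^-1` A)); exact: filterI.
Qed.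

(** * Weak convergence in a Hilbert space *)

Section weak_convergence.
Context {R : realType}.

Lemma ultra_bounded_cvg (X : Type) (U : set_system X) (f : X -> R) (M : R) :
  UltraFilter U -> (forall k, `|f k| <= M) -> cvg (f @ U).
Proof.
move=> UU fM; have fUU := ultra_fmap f UU.
have := @segment_compact R (- M) M; rewrite compact_ultra /=.
move=> /(_ _ fUU) [|l [_ fl]]; last first.
  by apply: (cvgP l).
by apply: (@filterE _ U) => k; rewrite /= in_itv /= -ler_norml.
Qed.

Context {V : hilbertType R}.
Implicit Types (x y z h : V) (u : nat -> V).

Lemma inner_cauchy_schwarz x y : `|inner x y| <= `|x| * `|y|.
Proof.
rewrite -(ler_pXn2r (n := 2)) ?nnegrE ?mulr_ge0 // real_normK ?num_real //.
by rewrite exprMn -!innerxx dot_cauchy_schwarz.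
Qed.

Lemma innerNl x y : inner (- x) y = - inner x y.
Proof. by rewrite -scaleN1r dotZl mulN1r. Qed.

Lemma innerNr x y : inner x (- y) = - inner x y.
Proof. by rewrite dotC innerNl dotC. Qed.

Lemma inner_eqP x y : (forall h, inner x h = inner y h) -> x = y.
Proof.
move=> xy; apply/eqP; rewrite -subr_eq0 -normr_eq0 -sqrf_eq0 -innerxx.
by rewrite dotDl innerNl xy subrr.
Qed.

Lemma inner_suml (I : finType) (c : I -> R) (d : I -> V) z :
  inner (\sum_i c i *: d i) z = \sum_i c i * inner (d i) z.
Proof.
by apply: (big_rec2 (fun a b => inner a z = b)) => [|i y1 y2 _ <-];
  rewrite ?dot0l// dotDl dotZl.
Qed.

Lemma cvg_inner (X : Type) (F : set_system X) (f : X -> V) y h :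
  Filter F -> f @ F --> y -> inner (f k) h @[k --> F] --> inner y h.
Proof.
move=> FF fy; apply/cvgrPdistC_lt => e e0.
have e1 : 0 < e / (`|h| + 1) by rewrite divr_gt0 // ltr_wpDl.
move/cvgrPdistC_lt : fy => /(_ _ e1); apply: filterS => k fk.
rewrite -innerNl -dotDl (le_lt_trans (inner_cauchy_schwarz _ _))//.
rewrite ltr_pdivlMr ?ltr_wpDl// in fk; apply: le_lt_trans fk.
by rewrite ler_wpM2l// lerDl.
Qed.

(* The representative minimizes [`|h| ^+ 2 - 2 * phi h]; minimizing sequences
   are Cauchy by the parallelogram law. *)
Lemma riesz (phi : V -> R) (M : R) :
  scalar phi -> (forall h, `|phi h| <= M * `|h|) ->
  exists y, forall h, phi h = inner y h.
Proof.
move=> phiL phiM.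
have phi0 : phi 0 = 0.
  by have := phiL 1 0 0; rewrite /= scale1r addr0 mul1r => ?; lra.
have phiD a b : phi (a + b) = phi a + phi b.
  by have := phiL 1 a b; rewrite /= scale1r mul1r.
have phiZ c a : phi (c *: a) = c * phi a.
  by have := phiL c a 0; rewrite /= addr0 phi0 addr0.
pose J h := inner h h - 2 * phi h.
have J_inf : has_inf (range J).
  split; first by exists (J 0), 0.
  exists (- M ^+ 2) => _ [h _ <-]; rewrite /J innerxx.
  have := phiM h; rewrite ler_norml => /andP[_ ?].
  by have := sqr_ge0 (`|h| - M); rewrite sqrrB => ?; lra.
pose d := inf (range J).
have Jd h : d <= J h by apply: ge_inf; [exact: J_inf.2|exists h].
have /choice[g gP] k : exists h, J h < d + k.+1%:R^-1.
  have k0 : 0 < k.+1%:R^-1 :> R by rewrite invr_gt0.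
  by have [_ [h _ <-] hd] := inf_adherent k0 J_inf; exists h.
have gJ k l : `|g k - g l| ^+ 2 <= 2 * (k.+1%:R^-1 + l.+1%:R^-1).
  (* At the midpoint, [|g k - g l| ^+ 2] equals [2 * J (g k) + 2 * J (g l) - 4 * J mid], and [J mid]
     is at least [d]. *)
  have := Jd (2^-1 *: (g k + g l)); have := gP k; have := gP l.
  rewrite -innerxx /J !(dotDl, dotDr, innerNl, innerNr, dotZl, dotZr).
  rewrite phiZ phiD (dotC _ (g l) (g k)).
  by move: (k.+1%:R^-1) (l.+1%:R^-1) => a b *; lra.
have : cvg (g @ \oo).
  apply: cauchy_cvg; apply/cauchyP => e e0.
  have e2 : 0 < e ^+ 2 / 4 by rewrite divr_gt0 ?exprn_gt0.
  have /cvgr0_norm_lt/(_ _ e2) [N _ HN] := @cvg_harmonic R.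
  exists (g N); exists N => // k /= Nk; rewrite -ball_normE /=.
  rewrite -(ltr_pXn2r (n := 2)) ?nnegrE ?(ltW e0)//.
  apply: le_lt_trans (gJ _ _) _.
  have := HN N (leqnn _); have := HN k Nk; rewrite /= !ger0_norm//.
  rewrite /harmonic /=.
  by move: (k.+1%:R^-1) (N.+1%:R^-1) (e ^+ 2) => a b c *; lra.
move=> /cvg_ex[/= y gy]; exists y => h.
(* First variation: this is [J (y + t *: h) - J y], obtained as a limit along [g] with error
   [harmonic k]. *)
have Q t : 0 <= 2 * t * (inner y h - phi h) + t ^+ 2 * inner h h.
  have c1 : 2 * t * (inner (g k) h - phi h) + t ^+ 2 * inner h h + harmonic k
      @[k --> \oo] --> 2 * t * (inner y h - phi h) + t ^+ 2 * inner h h + 0.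
    apply: cvgD; last exact: cvg_harmonic.
    apply: cvgD; last exact: cvg_cst.
    apply: cvgMr; apply: cvgB; last exact: cvg_cst.
    exact: cvg_inner.
  rewrite addr0 in c1.
  apply: (cvgr_to_ge c1); near=> k.
  have := Jd (g k + t *: h); have := gP k.
  rewrite /J /harmonic /= !(dotDl, dotDr, dotZl, dotZr) phiD phiZ.
  rewrite (dotC _ h (g k)); move: (k.+1%:R^-1) => a *; rewrite expr2; lra.
set c := inner y h - phi h in Q.
have G0 : 0 <= inner h h := dot_ge0 _ _.
have G1 : 0 < inner h h + 1 by lra.
(* Nearly the minimizing [t]; the [+ 1] covers [h = 0]. The value is negative unless [c = 0]. *)
have := Q (- c / (inner h h + 1)).
have -> : 2 * (- c / (inner h h + 1)) * c +
    (- c / (inner h h + 1)) ^+ 2 * inner h h =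
    - (c ^+ 2 * (inner h h + 2)) / (inner h h + 1) ^+ 2.
  by field; rewrite gt_eqF.
rewrite pmulr_lge0 ?invr_gt0 ?exprn_gt0// oppr_ge0 pmulr_lle0; last by lra.
rewrite -[_ <= 0]negbK -ltNge exprn_even_gt0//= negbK subr_eq0 => /eqP//.
Unshelve. all: by end_near. Qed.

(** By compactness of segments, each [inner (u k) h] converges along [U]; the limit is linear and
    bounded in [h], so Riesz represents it. *)
Lemma ultra_weak_cvg (X : Type) (U : set_system X) (u : X -> V) (M : R) :
  UltraFilter U -> (forall k, `|u k| <= M) ->
  exists y, forall h, inner (u k) h @[k --> U] --> inner y h.
Proof.
move=> UU uM.
have bnd h k : `|inner (u k) h| <= M * `|h|.
  by rewrite (le_trans (inner_cauchy_schwarz _ _)) ?ler_wpM2r.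
pose phi h := lim (inner (u k) h @[k --> U]).
have phiP h : inner (u k) h @[k --> U] --> phi h.
  exact: (@ultra_bounded_cvg _ U (fun k => inner (u k) h) (M * `|h|)).
have [||y phiE] := @riesz phi M.
- move=> a h h' /=.
  have : inner (u k) (a *: h + h') @[k --> U] --> a * phi h + phi h'.
    under eq_fun do rewrite dotDr dotZr.
    by apply: cvgD; [apply: cvgMr|]; exact: phiP.
  exact: (@cvg_unique _ (@Rhausdorff R) _ _ _ _ (phiP _)).
- move=> h; apply: (cvgr_to_le (cvg_norm (phiP h))).
  by apply: (@filterE _ U) => k; exact: bnd.
- by exists y => h; rewrite -phiE.
Qed.

(* A weak limit [g] along an ultrafilter is orthogonal to every [v q], hence to
   itself. *)
Lemma almost_orthogonal_weakly_cvg0 (v : nat -> V) (M : R) :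
  (forall k, `|v k| <= M) ->
  (forall q, inner (v l) (v q) @[l --> \oo] --> (0 : R)) -> weakly_cvg v 0.
Proof.
move=> vM v0 h; apply: cvg_ultra => U UU ooU.
have [g gP] := ultra_weak_cvg UU vM.
have gv q : inner g (v q) = 0.
  apply: (@cvg_unique _ (@Rhausdorff R) _ _ _ _ (gP (v q))).
  exact: cvg_trans (cvg_app _ ooU) (v0 q).
suff -> : 0 = g by exact: gP.
apply/esym/eqP; rewrite -normr_eq0 -sqrf_eq0 -innerxx; apply/eqP.
have : inner (v k) g @[k --> U] --> (0 : R).
  by under eq_fun do rewrite dotC gv; exact: cvg_cst.
exact: (@cvg_unique _ (@Rhausdorff R) _ _ _ _ (gP g)).
Qed.

Lemma ultra_weak_subseq (U : set_system nat) u (M : R) y :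
  UltraFilter U -> \oo `<=` U -> (forall k, `|u k| <= M) ->
  (forall h, inner (u k) h @[k --> U] --> inner y h) ->
  exists2 s : nat -> nat,
    forall l, (l <= s l)%N & weakly_cvg (fun l => u (s l)) y.
Proof.
move=> UU ooU uM uy.
have close l h : U [set k | `|inner (u k - y) h| < harmonic l].
  have l0 : 0 < harmonic l :> R by rewrite invr_gt0.
  have /cvgrPdistC_lt/(_ _ l0) := uy h.
  by apply: (@filterS _ U) => k /=; rewrite dotDl innerNl.
(* Diagonal choice: [u (s l) - y] is almost orthogonal to [y] and to all earlier [u p]. Since [s q]
   is a fixed index, [v l] is eventually tested against [u (s q)], hence against [v q]. *)
have /choice[s sP] l : exists k, [/\ (l <= k)%N,
    `|inner (u k - y) y| < harmonic l &
    forall p : 'I_l, `|inner (u k - y) (u p)| < harmonic l].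
  have Ul : U [set k | (l <= k)%N] by apply: ooU; exists l.
  have Up : U [set k | forall p : 'I_l, `|inner (u k - y) (u p)| < harmonic l].
    by apply: filter_forall => p; exact: close.
  have [k [[]]] := @filter_ex _ U _ _ (filterI (filterI Ul (close l y)) Up).
  by exists k.
exists s => [l|]; first by have [] := sP l.
pose v l := u (s l) - y.
have harm0 h : (\forall l \near \oo, `|inner (v l) h| < harmonic l) ->
    inner (v l) h @[l --> \oo] --> (0 : R).
  move=> vh; apply/norm_cvg0P; apply: squeeze_cvgr (cvg_cst 0) cvg_harmonic.
  by apply: filterS vh => l /ltW ->; rewrite normr_ge0.
have vy : inner (v l) y @[l --> \oo] --> (0 : R).
  by apply: harm0; apply: filterE => l; have [] := sP l.
have vu p : inner (v l) (u p) @[l --> \oo] --> (0 : R).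
  apply: harm0; exists p.+1 => // l /= pl.
  by have [_ _ /(_ (Ordinal pl))] := sP l.
have v0 : weakly_cvg v 0.
  apply: (@almost_orthogonal_weakly_cvg0 _ (M + `|y|)) => [l|q].
    by rewrite (le_trans (ler_normB _ _))// lerD2r.
  under eq_cvg do rewrite [v q]/v dotDr innerNr.
  by have := cvgB (vu (s q)) vy; rewrite subr0; exact.
move=> h; under eq_cvg do rewrite -[u _](subrK y) dotDl.
by have := cvgD (v0 h) (cvg_cst (inner y h)); rewrite dot0l add0r; exact.
Qed.

(* Opial: if [y] and [y0] are cluster points then [`|u k - y| ^+ 2 - `|u k - y0| ^+ 2]
   is affine in [inner (u k) (y - y0)], so the latter converges. *)
Lemma fejer_weakly_cvg u (F : set V) :
  F !=set0 -> (forall z k, F z -> `|u k.+1 - z| <= `|u k - z|) ->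
  (forall (s : nat -> nat) y, (forall l, (l <= s l)%N) ->
    weakly_cvg (fun l => u (s l)) y -> F y) ->
  exists2 y, F y & weakly_cvg u y.
Proof.
move=> [z0 Fz0] fejer cluster.
have uM k : `|u k| <= `|u 0%N - z0| + `|z0|.
  rewrite -[u k](subrK z0) (le_trans (ler_normD _ _))// lerD2r.
  by elim: k => // k; apply: le_trans; exact: fejer.
have lim_in U : UltraFilter U -> \oo `<=` U ->
    exists2 y, F y & forall h, inner (u k) h @[k --> U] --> inner y h.
  move=> UU ooU; have [y uy] := ultra_weak_cvg UU uM.
  have [s ls us] := ultra_weak_subseq UU ooU uM uy.
  by exists y => //; exact: cluster us.
have dist_cvg z : F z -> cvg (`|u k - z| ^+ 2 @[k --> \oo]).
  move=> Fz; apply: nonincreasing_is_cvgn.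
    apply/nonincreasing_seqP => k.
    by rewrite ler_pXn2r ?nnegrE// fejer.
  by exists 0 => _ [k _ <-]; exact: sqr_ge0.
(* The candidate is the limit along an arbitrary ultrafilter; all others are shown to give the same
   one. *)
have [U0 [UU0 ooU0]] := @ultraFilterLemma _ \oo _.
have [y0 Fy0 uy0] := lim_in U0 UU0 ooU0.
exists y0 => // h; apply: cvg_ultra => U UU ooU.
have [y Fy uy] := lim_in U UU ooU.
suff <- : y = y0 by exact: uy.
have [l cl] : exists l : R, inner (u k) (y - y0) @[k --> \oo] --> l.
  have /cvg_ex[/= a ca] := dist_cvg _ Fy.
  have /cvg_ex[/= b cb] := dist_cvg _ Fy0.
  pose e := inner y y - inner y0 y0.
  have uE k : inner (u k) (y - y0) =
      2^-1 * (`|u k - y0| ^+ 2 - `|u k - y| ^+ 2 + e).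
    rewrite -!innerxx !(dotDl, dotDr, innerNl, innerNr).
    by rewrite (dotC _ y (u k)) (dotC _ y0 (u k)) /e; field.
  exists (2^-1 * (b - a + e)); under eq_cvg do rewrite uE.
  exact: cvgMr (cvgD (cvgB cb ca) (cvg_cst e)).
have lim_eq W z : UltraFilter W -> \oo `<=` W ->
    (forall h, inner (u k) h @[k --> W] --> inner z h) -> inner z (y - y0) = l.
  move=> UW ooW uz; apply: (@cvg_unique _ (@Rhausdorff R) _ _ _ _ (uz _)).
  exact: cvg_trans (cvg_app _ ooW) cl.
apply/eqP; rewrite -subr_eq0 -normr_eq0 -sqrf_eq0 -innerxx; apply/eqP.
by rewrite {1}dotDl innerNl (lim_eq U y)// (lim_eq U0 y0)// subrr.
Qed.

(** * Decrease of the distance to a fixed point *)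

(** Expanding the square, the cross term gains at least [2 * lambda * D] and the quadratic term
    costs at most [lambda ^+ 2 * D]. *)
Lemma relaxed_average_fejer (I : finType) (w : I -> R) (d : I -> V) x z (lambda : R) :
  (forall i, 0 <= w i) -> \sum_i w i = 1 -> 0 <= lambda ->
  (forall i, w i != 0 -> inner (d i) (d i) <= inner (d i) (z - x)) ->
  lambda * (2 - lambda) * \sum_i w i * inner (d i) (d i) <=
  `|x - z| ^+ 2 - `|x + lambda *: (\sum_i w i *: d i) - z| ^+ 2.
Proof.
move=> w0 w1 l0 dz; set s := \sum_i w i *: d i; set D := \sum_i _.
have ss : inner s s <= D.
  (* Convexity of the squared norm, as nonnegativity of the weighted variance around the mean
     [s]. *)
  have : 0 <= \sum_i w i * inner (d i - s) (d i - s).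
    by apply: sumr_ge0 => i _; rewrite mulr_ge0 ?dot_ge0.
  have E i : w i * inner (d i - s) (d i - s) = w i * inner (d i) (d i) -
      2 * (w i * inner (d i) s) + w i * inner s s.
    by rewrite !(dotDl, dotDr, innerNl, innerNr) (dotC _ s (d i)); ring.
  rewrite (eq_bigr _ (fun i _ => E i)) big_split sumrB /= -mulr_sumr.
  by rewrite -mulr_suml w1 -inner_suml -/s -/D => ?; lra.
have sz : D <= inner s (z - x).
  rewrite inner_suml; apply: ler_sum => i _.
  by have [->|wi] := eqVneq (w i) 0; rewrite ?mul0r// ler_wpM2l// dz.
have -> : x + lambda *: s - z = (x - z) + lambda *: s by rewrite addrAC.
have E : inner s (z - x) = - inner (x - z) s.
  by rewrite -[z - x]opprB innerNr dotC.
rewrite {}E in sz; move: (x - z) sz => v sz.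
rewrite -!innerxx !(dotDl, dotDr, dotZl, dotZr) (dotC _ s v).
set a := inner v s in sz *.
have : lambda * D <= lambda * - a by rewrite ler_wpM2l.
have : lambda ^+ 2 * inner s s <= lambda ^+ 2 * D by rewrite ler_wpM2l ?sqr_ge0.
by rewrite expr2 => *; lra.
Qed.

End weak_convergence.

(** The sequence [a] is nonincreasing and bounded below, so its decrements tend to zero. *)
Lemma sqr_le_decrement_cvg0 (R : realType) (a b : nat -> R) (C : R) :
  0 < C -> (forall k, 0 <= a k) -> (forall k, 0 <= b k) ->
  (forall k, C * b k ^+ 2 <= a k - a k.+1) -> b @ \oo --> (0 : R).
Proof.
move=> C0 a0 b0 ba.
have /cvg_ex[/= l al] : cvg (a @ \oo).
  apply: nonincreasing_is_cvgn; last by exists 0 => _ [k _ <-].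
  apply/nonincreasing_seqP => k; rewrite -subr_ge0 (le_trans _ (ba k))//.
  by rewrite mulr_ge0 ?(ltW C0)// sqr_ge0.
have aS : a k.+1 @[k --> \oo] --> l by rewrite cvg_shiftS.
have da : (a k - a k.+1) @[k --> \oo] --> (0 : R).
  by rewrite -(subrr l); exact: cvgB al aS.
apply/cvgr0Pnorm_lt => e e0.
have Ce : 0 < C * e ^+ 2 by rewrite mulr_gt0 ?exprn_gt0.
apply: filterS (cvgr0_norm_lt _ da _ Ce) => k /= /(le_lt_trans (ler_norm _)).
move=> /(le_lt_trans (ba k)); rewrite ltr_pM2l// ger0_norm//.
by rewrite ltr_pXn2r ?nnegrE// ltW.
Qed.

(** * Cutters in one component, and the product space *)

Section componentwise.
Context {R : realType} {n : nat} {H : 'I_n -> hilbertType R}.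
Implicit Types (j : 'I_n) (T : hprod H -> hprod H) (x z : hprod H).

Lemma cutter_at_inner_le j T x z : cutter_at j T -> Fixc j T z ->
  inner (T x j - x j) (T x j - x j) <= inner (T x j - x j) (z j - x j).
Proof.
move=> [_ cutT] /cutT - /(_ x).
rewrite !(dotDl, dotDr, innerNl, innerNr) !(dotC _ (x j) (T x j)) => ?; lra.
Qed.

(** For a cutter, membership in [Fixc j T] depends on the [j]-th component alone: when [x j = z j]
    the cutter inequality bounds [|T x j - x j| ^+ 2] by zero. *)
Lemma cutter_at_Fixc j T x z :
  cutter_at j T -> Fixc j T z -> x j = z j -> Fixc j T x.
Proof.
move=> Tc Tz xz; have := cutter_at_inner_le x Tc Tz; rewrite xz subrr.
rewrite (dotC _ _ 0) dot0l innerxx => h; apply/eqP.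
by rewrite -subr_eq0 xz -normr_eq0 -sqrf_eq0 eq_le h sqr_ge0.
Qed.

End componentwise.

Lemma hprod_weakly_cvg (R : realType) (n : nat) (H : 'I_n -> hilbertType R)
    (x : nat -> hprod H) (y : hprod H) :
  (forall j, weakly_cvg (fun k => x k j) (y j)) -> weakly_cvg x y.
Proof.
move=> xy h; rewrite hprod_innerE; under eq_fun do rewrite hprod_innerE.
by apply: cvg_big => [|j _]; [exact: add_continuous|exact: xy].
Qed.

(** * Convergence of the simultaneous iteration *)

Theorem theorem27 (R : realType) (n m : nat) (n_ge2 : (2 <= n)%N)
    (H : 'I_n -> hilbertType R)
    (w : 'I_m -> 'I_n -> R)
    (w_ge0 : forall i j, 0 <= w i j)
    (w_sum1 : forall j, \sum_(i < m) w i j = 1)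
    (lambda : R) (lambda_gt0 : 0 < lambda) (lambda_lt2 : lambda < 2)
    (Ti : 'I_m -> hprod H -> hprod H)
    (Ti_cutter : forall i, cw_cutter (Ti i))
    (Ti_regular : forall i, cw_weakly_regular (Ti i))
    (Ti_common : (\bigcap_i Fix (Ti i)) !=set0)
    (T : hprod H -> hprod H)
    (T_def : forall x j,
       T x j = x j + lambda *: \sum_(i < m) w i j *: (Ti i x j - x j)) :
  Fix T = \bigcap_j Fixc j T /\
  forall x : nat -> hprod H,
    (forall k j, x k.+1 j =
       x k j + lambda *: \sum_(i < m) w i j *: (Ti i (x k) j - x k j)) ->
    exists2 xstar : hprod H, Fix T xstar & weakly_cvg x xstar.
Proof.
split.
  apply/seteqP; split=> [z Tz j _|z Tz]; first by rewrite /Fixc /= Tz.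
  by apply: hprodP => j; exact: Tz.
move=> x xS; have [c cP] := Ti_common.
(* Only operators with nonzero weight are asked to fix component [j], since only their residuals are
   controlled. *)
pose F j : set (H j) := [set a | exists2 z : hprod H, z j = a &
  forall i, w i j != 0 -> Fixc j (Ti i) z].
have decr j z : (forall i, w i j != 0 -> Fixc j (Ti i) z) -> forall k,
    lambda * (2 - lambda) * \sum_i w i j * `|Ti i (x k) j - x k j| ^+ 2 <=
    `|x k j - z j| ^+ 2 - `|x k.+1 j - z j| ^+ 2.
  move=> zF k; rewrite xS; under eq_bigr do rewrite -innerxx.
  apply: relaxed_average_fejer => //; first exact: ltW.
  by move=> i /zF; exact: cutter_at_inner_le (Ti_cutter i j).
have C0 : 0 < lambda * (2 - lambda) by rewrite mulr_gt0 ?subr_gt0.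
have Fc j : forall i, w i j != 0 -> Fixc j (Ti i) c.
  by move=> i _; rewrite /Fixc /= cP.
have residual j i : w i j != 0 ->
    `|Ti i (x k) j - x k j| @[k --> \oo] --> (0 : R).
  move=> wij; have wij0 : 0 < w i j by rewrite lt0r wij w_ge0.
  apply: (@sqr_le_decrement_cvg0 _ (fun k => `|x k j - c j| ^+ 2) _
    (lambda * (2 - lambda) * w i j)) => [|k|k|k] /=; first exact: mulr_gt0 C0 wij0.
  - exact: sqr_ge0.
  - exact: normr_ge0.
  apply: le_trans (decr j c (Fc j) k); rewrite -mulrA ler_wpM2l ?(ltW C0)//.
  rewrite (bigD1 i)//= lerDl sumr_ge0// => ? _.
  by rewrite mulr_ge0 ?sqr_ge0.
have /(_ _)/cid2 xj j : exists2 y, F j y & weakly_cvg (fun k => x k j) y.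
  apply: fejer_weakly_cvg => [|_ k [z <- zF]|s y ls sy].
  - by exists (c j), c; last exact: Fc.
  - rewrite -(ler_pXn2r (n := 2)) ?nnegrE// -subr_ge0.
    apply: le_trans (decr j z zF k); rewrite mulr_ge0 ?(ltW C0)// sumr_ge0//.
    by move=> i _; rewrite mulr_ge0 ?sqr_ge0.
  - have yE := dfwithin c y.
    (* Weak regularity concerns points of the product, so [y] is completed by the other components
       of [c]. *)
    exists (dfwith c j y : hprod H) => // i wij.
    apply: (Ti_regular i j).2 (x \o s) _ _ _; first by rewrite yE.
    apply: (@cvg_comp _ _ _ s _ _ \oo) (residual j i wij) => A [N _ NA].
    by exists N => // l /= Nl; apply: NA; exact: leq_trans (ls l).
pose xstar : hprod H := fun j => s2val (xj j).
exists xstar.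
  apply: hprodP => j; rewrite T_def big1 ?scaler0 ?addr0// => i _.
  have [->|wij] := eqVneq (w i j) 0; first by rewrite scale0r.
  have [z zE zF] := s2valP (xj j).
  (* The point [z] may differ from [xstar] outside component [j]; the cutter property carries the
     fixed component over. *)
  have := cutter_at_Fixc (x := xstar) (Ti_cutter i j) (zF i wij) (esym zE).
  by rewrite /Fixc /= => ->; rewrite subrr scaler0.
by apply: hprod_weakly_cvg => j; exact: s2valP' (xj j).
Qed.
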